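(* Let $N,F$ be positive integers, $\mathcal{N}=\{1,\dots,N\}$, $\mathcal{F}=\{1,\dots,F\}$. Let $P_r(1),\dots,P_r(F)$ be real numbers with $0<P_r(f)<1$ for all $f\in\mathcal{F}$ and $\sum_{f=1}^F P_r(f)=1$. Let $S>0$, let $M_i\ge 0$, $R_{e,i}>0$, $R_{b,i}>0$, $\lambda_i>0$ for $i\in\mathcal{N}$, and put $$\mu_{e,i}=\frac{R_{e,i}}{S},\qquad \mu_{b,i}=\frac{1}{S/R_{e,i}+S/R_{b,i}},$$ and assume $\lambda_i<\mu_{b,i}<\mu_{e,i}$ for all $i\in\mathcal{N}$. For a matrix $\mathbf{P}=(P(i,f))\in\mathbb{R}^{N\times F}$ define $$H_e(\mathbf{P})=\sum_{f=1}^F P_r(f)\Big[\sum_{i=1}^N P(i,f)\Big],$$ $$D_i(\mathbf{P})=\frac{H_e(\mathbf{P})}{\mu_{e,i}-\lambda_i H_e(\mathbf{P})}+\frac{1-H_e(\mathbf{P})}{\mu_{b,i}-\lambda_i\,[1-H_e(\mathbf{P})]},\qquad D(\mathbf{P})=\sum_{i=1}^N\frac{\lambda_i}{\sum_{j=1}^N\lambda_j}\,D_i(\mathbf{P}).$$ Let $\mathbf{p}=\langle P(i,f)\rangle_{i\in\mathcal{N},f\in\mathcal{F}}\in\mathbb{R}^{NF}$ be the vector of entries of $\mathbf{P}$. Then the optimization problem $$\min_{\mathbf{P}} D(\mathbf{P})\quad\text{subject to}\quad 0\le\sum_{i=1}^N P(i,f)\le 1\ \ \forall f\in\mathcal{F},\qquad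 \sum_{f=1}^F P(i,f)\,S\le M_i\ \ \forall i\in\mathcal{N},$$ is a convex optimization problem with respect to $\mathbf{p}$; that is, its feasible set is a convex subset of $\mathbb{R}^{NF}$ and the objective $D$, viewed as a function of $\mathbf{p}$, is convex on it.
   Context: Interpretation of the quantities (from a model of edge caching in fog computing networks): there are $N$ base stations, each with an attached fog node, and a library of $F$ contents, all of equal size $S$. $P(i,f)$ is the portion of content $f$ cached at fog node $i$; $\mathbf{P}$ is called the cache content placement matrix and $\mathbf{p}$ the cache content placement vector. $P_r(f)$ is the popularity (request probability) of content $f$; $M_i$ is the cache capacity of fog node $i$; $\lambda_i$ is the Poisson arrival rate of requests at base station $i$; $R_{e,i}$ and $R_{b,i}$ are the transmission rates from base station $i$ to users and from the cloud to base station $i$; $\mu_{e,i}$ and $\mu_{b,i}$ are the content provision rates in fog and cloud provision mode. $H_e(\mathbf{P})$ is the edge-cache-hit-ratio, $D_i$ the average download time at base station $i$, and $D$ the overall average download time. The conditions $\lambda_i<\mu_{b,i}<\mu_{e,i}$ are the queue stability conditions; they constrain only the fixed parameters, not the variable $\mathbf{P}$. *)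

(* Defs.v *)
From HB Require Import structures.
From mathcomp Require Import all_boot all_order all_algebra.
From mathcomp Require Import classical_sets reals convex.
Set Implicit Arguments.
Unset Strict Implicit.
Unset Printing Implicit Defensive.
Import Order.TTheory GRing.Theory Num.Theory.
Local Open Scope classical_set_scope.
Local Open Scope ring_scope.

Section EdgeCaching.
Variables (R : realType) (N F : nat).

(* Content size, and per-station rates to the users (Re) and from the
   cloud (Rb). In cloud mode a content is first fetched from the cloud and
   then sent to the user, so the two transmission times add up. *)
Definition mu_e (S : R) (Re : 'I_N -> R) (i : 'I_N) : R := Re i / S.

Definition mu_b (S : R) (Re Rb : 'I_N -> R) (i : 'I_N) : R :=
  1 / (S / Re i + S / Rb i).

(* Pr f is the popularity of content f, P i f the portion of f cached at node i. *)
Definition hit_ratio (Pr : 'I_F -> R) (P : 'M[R]_(N, F)) : R :=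
  \sum_(f < F) Pr f * (\sum_(i < N) P i f).

(* Both denominators are positive whenever 0 <= hit_ratio Pr P <= 1 and the
   stability conditions 0 < lam i < mu_b i < mu_e i hold, in particular on the
   feasible set below; elsewhere the convention x / 0 = 0 may come into play. *)
Definition delay (Pr : 'I_F -> R) (S : R) (Re Rb lam : 'I_N -> R)
    (P : 'M[R]_(N, F)) (i : 'I_N) : R :=
  let H := hit_ratio Pr P in
  H / (mu_e S Re i - lam i * H)
  + (1 - H) / (mu_b S Re Rb i - lam i * (1 - H)).

Definition avg_delay (Pr : 'I_F -> R) (S : R) (Re Rb lam : 'I_N -> R)
    (P : 'M[R]_(N, F)) : R :=
  \sum_(i < N) lam i / (\sum_(j < N) lam j) * delay Pr S Re Rb lam P i.

Definition feasible (S : R) (M : 'I_N -> R) (P : 'M[R]_(N, F)) : Prop :=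
  (forall f : 'I_F, 0 <= \sum_(i < N) P i f <= 1) /\
  (forall i : 'I_N, \sum_(f < F) P i f * S <= M i).

(* The placement vector p of dimension N * F is the row-major flattening of P:
   vec_mx : 'rV_(N * F) -> 'M_(N, F) is the inverse of mxvec. *)
Definition feasible_set (S : R) (M : 'I_N -> R) : set 'rV[R]_(N * F) :=
  [set p | feasible S M (vec_mx p)].

Definition objective (Pr : 'I_F -> R) (S : R) (Re Rb lam : 'I_N -> R)
    (p : 'rV[R]_(N * F)) : R :=
  avg_delay Pr S Re Rb lam (vec_mx p).

End EdgeCaching.

(* The problem "minimize g over A"; convex_function only constrains g on A. *)
Definition convex_problem (R : realType) (n : nat)
    (A : set 'rV[R]_n) (g : 'rV[R]_n -> R) : Prop :=
  @convex_set R 'rV[R]_n A /\ @convex_function R 'rV[R]_n A g.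

(* Main.v *)
(* The delays depend on the placement only through the hit ratio H, which is
   linear in P and lies in [0, 1] on the feasible set. Each delay is the sum of
   x / (m - l x) at x = H and at x = 1 - H, and x |-> x / (m - l x) is convex
   where m - l x > 0; stability gives that positivity for x <= 1. *)
Require Import Defs.
From mathcomp Require Import all_boot all_order all_algebra.
From mathcomp Require Import classical_sets reals convex.
From mathcomp Require Import interval_inference ring lra.
Import Order.TTheory GRing.Theory Num.Theory.
Local Open Scope ring_scope.

(** Over a common denominator, the right side minus the left is a nonnegative multiple of
    [(x - y) ^+ 2] divided by the product of the three denominators, so no derivative is
    involved. *)
Lemma sojourn_convex (R : realFieldType) (m l t x y : R) :
  0 <= m -> 0 <= l -> 0 <= t <= 1 -> 0 < m - l * x -> 0 < m - l * y ->
  (t * x + (1 - t) * y) / (m - l * (t * x + (1 - t) * y)) <=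
  t * (x / (m - l * x)) + (1 - t) * (y / (m - l * y)).
Proof.
move=> m0 l0 /andP[t0 t1] u0 v0; set z := t * x + (1 - t) * y.
have s0 : 0 <= 1 - t by rewrite subr_ge0.
have w0 : 0 < m - l * z.
  have -> : m - l * z = t * (m - l * x) + (1 - t) * (m - l * y).
    by rewrite /z; ring.
  (* At [t = 0] only the term in [y] remains; otherwise the term in [x] is positive and the other is
     nonnegative. *)
  have [->|t_neq0] := eqVneq t 0; first by rewrite mul0r add0r subr0 mul1r.
  apply: ltr_wpDr; first by rewrite mulr_ge0// ltW.
  by rewrite mulr_gt0// lt_def t_neq0.
have gapE : t * (x / (m - l * x)) + (1 - t) * (y / (m - l * y))
    - z / (m - l * z) = m * l * t * (1 - t) * (x - y) ^+ 2
      / ((m - l * x) * (m - l * y) * (m - l * z)).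
  by move: w0; rewrite /z => w0; field; rewrite !lt0r_neq0.
rewrite -subr_ge0 gapE divr_ge0 ?(mulr_ge0 _ (sqr_ge0 _)) ?mulr_ge0//.
all: by rewrite ltW.
Qed.

Section Placement.
Variables (R : realType) (N F : nat).
Implicit Types (P Q : 'M[R]_(N, F)) (Pr : 'I_F -> R) (S : R).
Implicit Types (M Re Rb lam : 'I_N -> R).

Lemma hit_ratio_comb Pr (a b : R) P Q :
  hit_ratio Pr (a *: P + b *: Q) = a * hit_ratio Pr P + b * hit_ratio Pr Q.
Proof.
rewrite /hit_ratio !mulr_sumr -big_split; apply: eq_bigr => f _ /=.
rewrite !mulr_sumr -big_split; apply: eq_bigr => i _ /=.
by rewrite !mxE; ring.
Qed.

(** The hit ratio is an average, with weights [Pr f], of column sums that feasibility keeps between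
    0 and 1. *)
Lemma hit_ratio_itv {Pr S M P} :
  (forall f, 0 <= Pr f) -> \sum_(f < F) Pr f = 1 -> feasible S M P ->
  0 <= hit_ratio Pr P <= 1.
Proof.
move=> Pr0 Pr1 [P01 _]; apply/andP; split.
  by apply: sumr_ge0 => f _; have /andP[? _] := P01 f; rewrite mulr_ge0.
rewrite -[leRHS]Pr1; apply: ler_sum => f _.
by have /andP[_ ?] := P01 f; rewrite ler_piMr.
Qed.

Lemma feasible_comb S M (t : R) P Q : 0 <= t <= 1 ->
  feasible S M P -> feasible S M Q -> feasible S M (t *: P + (1 - t) *: Q).
Proof.
move=> /andP[t0 t1] [P01 PM] [Q01 QM]; split=> [f|i].
  have -> : \sum_(i < N) (t *: P + (1 - t) *: Q) i f
      = t * \sum_(i < N) P i f + (1 - t) * \sum_(i < N) Q i f.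
    by rewrite !mulr_sumr -big_split; apply: eq_bigr => i _; rewrite !mxE.
  by have := P01 f; have := Q01 f; nra.
have -> : \sum_(f < F) (t *: P + (1 - t) *: Q) i f * S
    = t * \sum_(f < F) P i f * S + (1 - t) * \sum_(f < F) Q i f * S.
  rewrite !mulr_sumr -big_split; apply: eq_bigr => f _ /=.
  by rewrite !mxE; ring.
by have := PM i; have := QM i; nra.
Qed.

Lemma delay_comb Pr S Re Rb lam (t : R) P Q (i : 'I_N) : 0 <= t <= 1 ->
  0 < lam i -> lam i < mu_b S Re Rb i -> lam i < mu_e S Re i ->
  0 <= hit_ratio Pr P <= 1 -> 0 <= hit_ratio Pr Q <= 1 ->
  delay Pr S Re Rb lam (t *: P + (1 - t) *: Q) i <=
  t * delay Pr S Re Rb lam P i + (1 - t) * delay Pr S Re Rb lam Q i.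
Proof.
move=> t01 l0 lb le; rewrite /delay hit_ratio_comb.
set x := hit_ratio Pr P; set y := hit_ratio Pr Q.
move=> /andP[x0 x1] /andP[y0 y1].
(* Used with [h] a hit ratio and with [h] a miss ratio; the latter is at most 1 because the hit
   ratio is nonnegative. *)
have den_gt0 m h : lam i < m -> h <= 1 -> 0 < m - lam i * h.
  by move=> lm h1; rewrite subr_gt0 (le_lt_trans _ lm)// ler_piMr// ltW.
(* As the weights sum to 1, miss ratios mix like hit ratios, and [sojourn_convex] applies to each
   summand. *)
have -> : 1 - (t * x + (1 - t) * y) = t * (1 - x) + (1 - t) * (1 - y) by ring.
rewrite [in leRHS](mulrDr t) [in leRHS](mulrDr (1 - t)) addrACA.
rewrite lerD// sojourn_convex ?den_gt0 ?gerBl//.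
all: by rewrite ltW// (lt_trans l0).
Qed.

Lemma avg_delay_comb Pr S Re Rb lam (t : R) P Q : 0 <= t <= 1 ->
  (forall i, 0 < lam i) ->
  (forall i, lam i < mu_b S Re Rb i) -> (forall i, lam i < mu_e S Re i) ->
  0 <= hit_ratio Pr P <= 1 -> 0 <= hit_ratio Pr Q <= 1 ->
  avg_delay Pr S Re Rb lam (t *: P + (1 - t) *: Q) <=
  t * avg_delay Pr S Re Rb lam P + (1 - t) * avg_delay Pr S Re Rb lam Q.
Proof.
move=> t01 l0 lb le P01 Q01.
rewrite /avg_delay !mulr_sumr -big_split; apply: ler_sum => i _ /=.
(* The traffic share of station [i] is factored out; being nonnegative, it preserves the
   inequality. *)
rewrite (mulrCA t) (mulrCA (1 - t)) -mulrDr ler_wpM2l ?delay_comb//.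
by rewrite divr_ge0 ?sumr_ge0// => [|j _]; rewrite ltW.
Qed.

End Placement.

Theorem theorem1 (R : realType) (N F : nat) (N_gt0 : (0 < N)%N)
    (F_gt0 : (0 < F)%N) (Pr : 'I_F -> R) (S : R) (M Re Rb lam : 'I_N -> R)
    (Pr_itv : forall f : 'I_F, 0 < Pr f < 1)
    (Pr_sum : \sum_(f < F) Pr f = 1)
    (S_gt0 : 0 < S)
    (M_ge0 : forall i : 'I_N, 0 <= M i)
    (Re_gt0 : forall i : 'I_N, 0 < Re i)
    (Rb_gt0 : forall i : 'I_N, 0 < Rb i)
    (lam_gt0 : forall i : 'I_N, 0 < lam i)
    (stable : forall i : 'I_N, lam i < mu_b S Re Rb i < mu_e S Re i) :
  convex_problem (feasible_set (F := F) S M) (objective Pr S Re Rb lam).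
Proof.
have Pr_ge0 f : 0 <= Pr f by have /andP[/ltW] := Pr_itv f.
have t01 (t : {i01 R}) : 0 <= t%:num <= 1 by rewrite ge0 le1.
(* Linearity of [vec_mx] carries convex combinations of placement vectors to those of matrices,
   where the lemmas above apply. *)
have vec_mx_conv (t : {i01 R}) (p q : convex_lmodType 'rV[R]_(N * F)) :
    vec_mx (conv t p q : 'rV[R]_(N * F))
    = t%:num *: vec_mx p + (1 - t%:num) *: vec_mx q.
  by rewrite linearD !linearZ.
split=> [p q t /set_mem pA /set_mem qA|t p q /set_mem pA /set_mem qA].
  by apply/mem_set; rewrite /feasible_set/= vec_mx_conv; exact: feasible_comb.
rewrite /objective vec_mx_conv; apply: avg_delay_comb => //.
- by move=> i; have /andP[] := stable i.
- by move=> i; have /andP[lb be] := stable i; exact: lt_trans be.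
- exact: hit_ratio_itv Pr_ge0 Pr_sum pA.
- exact: hit_ratio_itv Pr_ge0 Pr_sum qA.
Qed.
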